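(* Let $\mathcal M$ be a compact separable metric space with metric $\rho$ and nonnegative Borel measure $\mu$, $\mu(\mathcal M)=1$, and let $\mathcal R_N=\{V_i\}_{i=1}^N$ be an equal measure partition of $\mathcal M$. Then $$\rho_N(\mathcal M)\ge N^2\langle\rho\rangle-N\|\mathcal R_N\|_1.$$ If additionally $\xi$ is a finite nonnegative measure on $T$ with $\xi([a,b))\le c_0(\xi)|a-b|$ for all $a\le b$, $a,b\in T$, for some constant $c_0(\xi)>0$, then $$\lambda_N(\xi,\mathcal M)\le\tfrac12\,c_0(\xi)\,N\,\|\mathcal R_N\|_1.$$
   Context: $B_r(y)=\{x:\rho(x,y)\le r\}$; $T=\{\rho(y_1,y_2):y_1,y_2\in\mathcal M\}$. An equal measure partition is a family of measurable $V_1,\dots,V_N$ with $\mu(\mathcal M\setminus\bigcup V_i)=0$, $\mu(V_i\cap V_j)=0$ ($i\ne j$), $\mu(V_i)=1/N$. Its average diameter is $\|\mathcal R_N\|_1=\frac1N\sum_{i=1}^N\mathrm{diam}(\rho,V_i)$ where $\mathrm{diam}(\rho,V)=\sup\{\rho(y_1,y_2):y_1,y_2\in V\}$. For an $N$-point set $\mathcal D_N=\{x_1,\dots,x_N\}\subset\mathcal M$: $\rho[\mathcal D_N]=\sum_{i,j}\rho(x_i,x_j)$; $\langle\rho\rangle=\iint\rho(y_1,y_2)\,d\mu(y_1)d\mu(y_2)$; $\lambda_r[\mathcal D_N]=\int_{\mathcal M}\big(\#(B_r(y)\cap\mathcal D_N)-N\mu(B_r(y))\big)^2d\mu(y)$;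 $\lambda[\xi,\mathcal D_N]=\int_T\lambda_r[\mathcal D_N]\,d\xi(r)$. $\rho_N(\mathcal M)=\sup_{\mathcal D_N}\rho[\mathcal D_N]$ and $\lambda_N(\xi,\mathcal M)=\inf_{\mathcal D_N}\lambda[\xi,\mathcal D_N]$ over all $N$-point distributions. *)

(* Defs.v *)
From HB Require Import structures.
From mathcomp Require Export all_boot all_order all_algebra finmap.
From mathcomp Require Export all_classical all_reals all_analysis.
Set Implicit Arguments.
Unset Strict Implicit.
Unset Printing Implicit Defensive.
Import Order.TTheory GRing.Theory Num.Theory.
Import numFieldNormedType.Exports.

Local Open Scope classical_set_scope.
Local Open Scope ring_scope.

(* Measurable types are pointed in the library, hence the base point. A space
   carrying a probability measure is nonempty, so nothing is lost. *)
#[short(type="pmetricType")]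
HB.structure Definition PointedMetric (K : numDomainType) :=
  { M of PseudoPointedMetric K M & Metric K M }.

Definition borel (R : realType) (M : pmetricType R) :=
  g_sigma_algebraType (@open M).

Section Defs.
Context {R : realType} {M : pmetricType R}.
Implicit Types (mu : probability (borel M) R) (N : nat).

Definition separable : Prop := exists2 S : set M, countable S & dense S.

(* Not the library's [closed_ball], which is the closure of the open ball and
   can be strictly smaller. *)
Definition cball (r : R) (y : M) : set M := [set x | mdist x y <= r].

Definition distances : set R := [set mdist y1 y2 | y1 in [set: M] & y2 in [set: M]].

Definition diam (V : set M) : \bar R :=
  ereal_sup [set (mdist y1 y2)%:E | y1 in V & y2 in V].

Definition equal_measure_partition mu N (V : 'I_N -> set (borel M)) : Prop :=
  [/\ forall i, measurable (V i),
      mu (~` (\bigcup_i V i)) = 0%E,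
      forall i j, i != j -> mu (V i `&` V j) = 0%E
    & forall i, mu (V i) = (N%:R^-1)%:E].

Definition avg_diam N (V : 'I_N -> set M) : \bar R :=
  ((N%:R^-1)%:E * \sum_(i < N) diam (V i))%E.

Definition mean_dist mu : \bar R :=
  (\int[mu]_y1 \int[mu]_y2 (mdist (y1 : M) (y2 : M))%:E)%E.

Definition sum_dist (D : {fset M}) : R :=
  \sum_(x1 <- D) \sum_(x2 <- D) mdist x1 x2.

Definition ball_discrepancy mu (r : R) (D : {fset M}) : \bar R :=
  (\int[mu]_y ((#|` [fset x in D | x \in cball r (y : M)]%fset|%:R
                - #|` D|%:R * fine (mu (cball r (y : M)))) ^+ 2)%:E)%E.

(* A measure on the set of distances is a Borel measure on R; the theorem also
   asks that it vanish outside [distances]. *)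
Definition discrepancy mu (xi : {finite_measure set (measurableTypeR R) -> \bar R})
    (D : {fset M}) : \bar R :=
  (\int[xi]_(r in distances) ball_discrepancy mu r D)%E.

Definition max_sum_dist N : \bar R :=
  ereal_sup [set (sum_dist D)%:E | D in [set D : {fset M} | #|` D| = N]].

Definition min_discrepancy mu xi N : \bar R :=
  ereal_inf [set discrepancy mu xi D | D in [set D : {fset M} | #|` D| = N]].

End Defs.

Arguments separable {R} M.
Arguments distances {R} M.
Arguments max_sum_dist {R} M N.

(* Main.v *)
(* Put N times the indicator of V_i as a probability density on V_i (after
   removing the null overlaps), and draw the points x_i independently. For a
   symmetric kernel K the expectation of the sum of all K(x_i, x_j) is

     N^2 <K> + sum_i (E K(x, x) - E K(x, x')),   x, x' independent in V_i,

   so some choice does at least as well, and each defect is half the mean of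
   K(x, x) + K(x', x') - 2 K(x, x'). For K = -rho that is 2 rho(x, x') and gives
   the first inequality. The discrepancy is also such a sum, for the kernel

     K(x, x') = int int (1_B - mu B)(x) (1_B - mu B)(x') dmu(y) dxi(r), B = B_r(y),

   for which <K> = 0. There K(x, x) + K(x', x') - 2 K(x, x') is the measure of
   the set of (r, y) whose ball separates x and x'; for fixed y these r form the
   interval between rho(x, y) and rho(x', y), of xi-measure at most
   c0 rho(x, x'). *)
From HB Require Import structures.
Require Import Defs.
From mathcomp Require Import measurable_realfun ring lra.
Set Implicit Arguments.
Unset Strict Implicit.
Unset Printing Implicit Defensive.
Import Order.TTheory GRing.Theory Num.Theory.
Import numFieldNormedType.Exports.
Local Open Scope classical_set_scope.
Local Open Scope ring_scope.

(** * Bounded measurable functions and their integrals *)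

Definition bounded_measurable d (T : measurableType d) (R : realType) (f : T -> R) :=
  measurable_fun setT f /\ exists C, forall x, `|f x| <= C.

Section BoundedMeasurable.
Context d (T : measurableType d) {R : realType}.
Implicit Types f g : T -> R.

Lemma bm_cst (c : R) : bounded_measurable (fun _ : T => c).
Proof. by split; [exact: measurable_cst|exists `|c|]. Qed.

Lemma bmD f g : bounded_measurable f -> bounded_measurable g ->
  bounded_measurable (fun x => f x + g x).
Proof.
move=> [mf [C fC]] [mg [C' gC]]; split; first exact: measurable_funD.
by exists (C + C') => x; rewrite (le_trans (ler_normD _ _))// lerD.
Qed.

Lemma bmM f g : bounded_measurable f -> bounded_measurable g ->
  bounded_measurable (fun x => f x * g x).
Proof.
move=> [mf [C fC]] [mg [C' gC]]; split; first exact: measurable_funM.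
by exists (C * C') => x; rewrite normrM ler_pM.
Qed.

Lemma bmZ c f : bounded_measurable f -> bounded_measurable (fun x => c * f x).
Proof. exact/bmM/bm_cst. Qed.

Lemma bmB f g : bounded_measurable f -> bounded_measurable g ->
  bounded_measurable (fun x => f x - g x).
Proof.
move=> bf bg; have := bmD bf (bmZ (-1) bg).
by under eq_fun do rewrite mulN1r.
Qed.

Lemma bm_sum (I : Type) (s : seq I) (F : I -> T -> R) :
  (forall i, bounded_measurable (F i)) ->
  bounded_measurable (fun x => \sum_(i <- s) F i x).
Proof.
move=> bF; elim: s => [|i s IH].
  by under eq_fun do rewrite big_nil; exact: bm_cst.
by under eq_fun do rewrite big_cons; exact: bmD.
Qed.

Lemma bm_comp d' (T' : measurableType d') (h : T' -> T) f :
  measurable_fun setT h -> bounded_measurable f -> bounded_measurable (f \o h).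
Proof.
move=> mh [mf [C fC]]; split; first exact: measurableT_comp.
by exists C => x; exact: fC.
Qed.

Section Integral.
Variable mu : {finite_measure set T -> \bar R}.

(** Total mass is finite, so boundedness suffices; the linearity, monotonicity and Fubini steps
    below all draw their integrability conditions from this class. *)
Lemma bm_integrable f : bounded_measurable f -> mu.-integrable setT (EFin \o f).
Proof.
move=> [mf [C fC]]; apply: measurable_bounded_integrable => //.
  by rewrite -ge0_fin_numE// fin_num_measure.
by exists C; split; [exact: num_real|move=> c Cc x _; exact: le_trans (ltW Cc)].
Qed.

Lemma bm_RintegralE f : bounded_measurable f ->
  (\int[mu]_x (f x)%:E)%E = (\int[mu]_x f x)%:E.
Proof.
by move=> bf; rewrite fineK//; apply: integrable_fin_num => //; exact: bm_integrable.
Qed.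

Lemma bm_RintegralD f g : bounded_measurable f -> bounded_measurable g ->
  \int[mu]_x (f x + g x) = \int[mu]_x f x + \int[mu]_x g x.
Proof. by move=> bf bg; rewrite RintegralD//; exact: bm_integrable. Qed.

Lemma bm_RintegralB f g : bounded_measurable f -> bounded_measurable g ->
  \int[mu]_x (f x - g x) = \int[mu]_x f x - \int[mu]_x g x.
Proof. by move=> bf bg; rewrite RintegralB//; exact: bm_integrable. Qed.

Lemma bm_RintegralZ c f : bounded_measurable f ->
  \int[mu]_x (c * f x) = c * \int[mu]_x f x.
Proof. by move=> bf; rewrite RintegralZl//; exact: bm_integrable. Qed.

Lemma bm_RintegralN f : bounded_measurable f -> \int[mu]_x - f x = - \int[mu]_x f x.
Proof.
move=> bf; rewrite -mulN1r -bm_RintegralZ//.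
by apply: eq_Rintegral => x _; rewrite mulN1r.
Qed.

Lemma bm_Rintegral_sum (I : Type) (s : seq I) (F : I -> T -> R) :
  (forall i, bounded_measurable (F i)) ->
  \int[mu]_x (\sum_(i <- s) F i x) = \sum_(i <- s) \int[mu]_x F i x.
Proof.
move=> bF; elim: s => [|i s IH].
  rewrite big_nil -[RHS](mul0r (fine (mu setT))) -Rintegral_cst//.
  by apply: eq_Rintegral => x _; rewrite big_nil.
rewrite big_cons -IH -bm_RintegralD//; last exact: bm_sum.
by apply: eq_Rintegral => x _; rewrite big_cons.
Qed.

Lemma le_bm_Rintegral f g : bounded_measurable f -> bounded_measurable g ->
  (forall x, f x <= g x) ->
  \int[mu]_x f x <= \int[mu]_x g x.
Proof. by move=> bf bg fg; apply: le_Rintegral => //; exact: bm_integrable. Qed.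

Lemma bm_norm f : bounded_measurable f -> bounded_measurable (fun x => `|f x|).
Proof.
move=> [mf [C fC]]; split; first exact: measurableT_comp.
by exists C => x; rewrite normr_id.
Qed.

End Integral.
End BoundedMeasurable.

(** * Fubini's theorem for bounded functions *)

Section Fubini.
Context d d' (T : measurableType d) (T' : measurableType d') {R : realType}.
Variables (mu : {finite_measure set T -> \bar R}).
Variables (nu : {finite_measure set T' -> \bar R}).
Variable f : T * T' -> R.
Hypothesis bf : bounded_measurable f.

Lemma bm_integrable_prod : (mu \x nu)%E.-integrable setT (EFin \o f).
Proof.
have [mf [C fC]] := bf.
apply: measurable_bounded_integrable => //.
  rewrite -setXTT [ltLHS]product_measure1E//.
  by rewrite -ge0_fin_numE ?mule_ge0// fin_numM// fin_num_measure.
by exists C; split; [exact: num_real|move=> c Cc x _; exact: le_trans (ltW Cc)].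
Qed.

Lemma bm_pair1 y : bounded_measurable (fun x => f (x, y)).
Proof. by apply: (bm_comp (h := fun x => (x, y))) => //; exact: measurable_pair2. Qed.

Lemma bm_pair2 x : bounded_measurable (fun y => f (x, y)).
Proof. by apply: (bm_comp (h := fun y => (x, y))) => //; exact: measurable_pair1. Qed.

(** Measurability comes from Fubini, and a bound on [f] times the total mass of [nu] is a bound
    here. Iterated integrals thus stay in the class. *)
Lemma bm_Rintegral1 : bounded_measurable (fun x => \int[nu]_y f (x, y)).
Proof.
have [_ [C fC]] := bf; split.
  apply/measurable_EFinP.
  rewrite [X in measurable_fun _ X](_ : _ = fubini_F nu (EFin \o f)).
    by apply: (measurable_fubini_F (m1 := mu)); exact: bm_integrable_prod.
  by apply/funext => x /=; rewrite -bm_RintegralE//; exact: bm_pair2.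
exists (C * fine (nu setT)) => x.
apply: le_trans (le_normr_Rintegral _ _) _ => //.
  exact/bm_integrable/bm_pair2.
rewrite -Rintegral_cst//; apply: le_bm_Rintegral => //.
- exact/bm_norm/bm_pair2.
- exact: bm_cst.
Qed.

Lemma bm_Fubini :
  \int[mu]_x \int[nu]_y f (x, y) = \int[nu]_y \int[mu]_x f (x, y).
Proof.
rewrite /Rintegral; congr fine.
transitivity (\int[mu]_x \int[nu]_y (f (x, y))%:E)%E.
  by apply: eq_integral => x _; rewrite -bm_RintegralE//; exact: bm_pair2.
rewrite (Fubini (f := EFin \o f)); last exact: bm_integrable_prod.
by apply: eq_integral => y _; rewrite -bm_RintegralE//; exact: bm_pair1.
Qed.

End Fubini.

Section ProductMeasure.
Context d d' (T : measurableType d) (T' : measurableType d') {R : realType}.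
Variables (mu : {finite_measure set T -> \bar R}).
Variables (nu : {finite_measure set T' -> \bar R}).

(** A named copy of the product measure, to carry the finite-measure structure declared below; the
    lemmas on bounded functions then apply to it. *)
Definition prod_measure : set (T * T') -> \bar R := (mu \x nu)%E.

HB.instance Definition _ := Measure.on prod_measure.

Let prod_measure_fin : fin_num_fun prod_measure.
Proof.
apply: lty_fin_num_fun; rewrite -setXTT [ltLHS]product_measure1E//.
by rewrite -ge0_fin_numE ?mule_ge0// fin_numM// fin_num_measure.
Qed.

HB.instance Definition _ := Measure_isFinite.Build _ _ _ prod_measure
  prod_measure_fin.

End ProductMeasure.

(** * Double sums of symmetric kernels *)

Section UpperSum.
Context {R : comNzRingType}.

(** The sum over pairs of positions i < j, in a recursive form that matches choosing the points one
    after another. *)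
Fixpoint upper_sum (S : Type) (F : S -> S -> R) (s : seq S) : R :=
  if s is x :: s' then \sum_(y <- s') F x y + upper_sum F s' else 0.

Lemma double_sum_upper (S : Type) (F : S -> S -> R) (s : seq S) :
  (forall x y, F x y = F y x) ->
  \sum_(x <- s) \sum_(y <- s) F x y = \sum_(x <- s) F x x + 2 * upper_sum F s.
Proof.
move=> Fsym; elim: s => [|x s IH]; first by rewrite !big_nil/= mulr0 addr0.
rewrite big_cons big_cons [X in _ + X](_ : _ = \sum_(y <- s) F x y +
    \sum_(z <- s) \sum_(y <- s) F z y); last first.
  by rewrite -big_split; apply: eq_bigr => z _; rewrite big_cons Fsym.
rewrite {}IH big_cons/=; ring.
Qed.

Lemma upper_sum_map (S S' : Type) (f : S -> S') (F : S' -> S' -> R) s :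
  upper_sum F (map f s) = upper_sum (fun x y => F (f x) (f y)) s.
Proof. by elim: s => //= x s ->; rewrite big_map. Qed.

End UpperSum.

(** * Expectations under densities and the choice of good points *)

Section Sampling.
Context d (T : measurableType d) {R : realType}.
Variable mu : {finite_measure set T -> \bar R}.
Implicit Types (w h : T -> R) (K : T -> T -> R).

Definition bounded_density w :=
  [/\ bounded_measurable w, forall x, 0 <= w x & \int[mu]_x w x = 1].

Definition mean w h : R := \int[mu]_x (w x * h x).

Lemma meanD w f g :
  bounded_measurable w -> bounded_measurable f -> bounded_measurable g ->
  mean w (fun x => f x + g x) = mean w f + mean w g.
Proof.
move=> bw bf bg; rewrite /mean; under eq_Rintegral do rewrite mulrDr.
by rewrite bm_RintegralD//; exact: bmM.
Qed.

Lemma meanZ w c f : bounded_measurable w -> bounded_measurable f ->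
  mean w (fun x => c * f x) = c * mean w f.
Proof.
move=> bw bf; rewrite /mean; under eq_Rintegral do rewrite mulrCA.
by rewrite bm_RintegralZ//; exact: bmM.
Qed.

Lemma meanB w f g :
  bounded_measurable w -> bounded_measurable f -> bounded_measurable g ->
  mean w (fun x => f x - g x) = mean w f - mean w g.
Proof.
move=> bw bf bg; rewrite /mean; under eq_Rintegral do rewrite mulrBr.
by rewrite bm_RintegralB//; exact: bmM.
Qed.

Lemma mean_sum (I : Type) (s : seq I) w (F : I -> T -> R) :
  bounded_measurable w -> (forall i, bounded_measurable (F i)) ->
  mean w (fun x => \sum_(i <- s) F i x) = \sum_(i <- s) mean w (F i).
Proof.
move=> bw bF; rewrite /mean -bm_Rintegral_sum; last by move=> i; exact: bmM.
by under eq_Rintegral do rewrite mulr_sumr.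
Qed.

Lemma mean_cst w c : bounded_density w -> mean w (fun=> c) = c.
Proof.
case=> bw _ w1; rewrite /mean; under eq_Rintegral do rewrite mulrC.
by rewrite bm_RintegralZ// w1 mulr1.
Qed.

Lemma le_mean w f g :
  bounded_density w -> bounded_measurable f -> bounded_measurable g ->
  (forall x, w x != 0 -> f x <= g x) -> mean w f <= mean w g.
Proof.
move=> [bw w0 _] bf bg fg; apply: le_bm_Rintegral; [exact: bmM..|] => x.
have [->|/fg] := eqVneq (w x) 0; first by rewrite !mul0r.
by move=> fgx; rewrite ler_wpM2l.
Qed.

(** First moment argument: otherwise [w x * (h x - a)] is nonnegative with integral 0, hence null
    almost everywhere, which forces [w] to vanish almost everywhere although its integral is 1. *)
Lemma exists_le_mean w h : bounded_density w -> bounded_measurable h ->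
  exists2 x, w x != 0 & h x <= mean w h.
Proof.
move=> dw bh; have [bw w0 w1] := dw; apply: contrapT => nex.
set a := mean w h in nex.
have ha x : w x != 0 -> 0 < h x - a.
  by move=> wx; rewrite subr_gt0 ltNge; apply/negP => hx; apply: nex; exists x.
have bha : bounded_measurable (fun x => w x * (h x - a)).
  by apply: bmM => //; apply: bmB => //; exact: bm_cst.
have i0 : \int[mu]_x (w x * (h x - a)) = 0.
  by rewrite -/(mean w (fun x => h x - a)) meanB ?mean_cst// ?subrr//; exact: bm_cst.
have p0 x : 0 <= w x * (h x - a).
  have [->|/ha/ltW] := eqVneq (w x) 0; first by rewrite mul0r.
  exact: mulr_ge0.
pose F : T -> \bar R := EFin \o (fun x => w x * (h x - a)).
have mF : measurable_fun setT F by apply/measurable_EFinP; case: bha.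
have : (\int[mu]_x `|F x| = 0)%E.
  under eq_integral do rewrite /F/= ger0_norm//.
  by rewrite bm_RintegralE// i0.
move/(ae_eq_integral_abs mu measurableT mF) => ae0.
have : ae_eq mu setT (EFin \o w) (cst 0%E).
  apply: filterS ae0 => x /= /(_ I) [] /eqP; rewrite mulf_eq0 => /orP[/eqP -> //|].
  by move=> h0 _; congr EFin; apply/eqP; apply: contraTT h0 => /ha/gt_eqF ->.
move=> w_ae0; have : (\int[mu]_x (w x)%:E = 0)%E.
  rewrite (ae_eq_integral (cst 0%E))//; first by rewrite integral0.
  by apply/measurable_EFinP; case: bw.
by rewrite bm_RintegralE// w1 => -[] /eqP; rewrite oner_eq0.
Qed.

Section Kernel.
Variable K : T -> T -> R.
Hypothesis bK : bounded_measurable (fun z : T * T => K z.1 z.2).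
Hypothesis Ksym : forall x y, K x y = K y x.

Definition mean2 w w' : R := mean w (fun x => mean w' (K x)).

Lemma bm_kernel x : bounded_measurable (K x).
Proof. exact: (bm_pair2 bK x). Qed.

Lemma bm_kernel_diag : bounded_measurable (fun x => K x x).
Proof.
apply: (bm_comp (h := fun x : T => (x, x)) _ bK).
exact: measurable_fun_pair.
Qed.

Lemma bm_mean_kernel w :
  bounded_measurable w -> bounded_measurable (fun x => mean w (K x)).
Proof.
move=> bw; apply: (bm_Rintegral1 mu mu (f := fun z => w z.2 * K z.1 z.2)).
by apply: bmM bK; exact: (bm_comp _ bw).
Qed.

(** Fubini and the symmetry of [K]; this makes [double_sum_upper] applicable to [mean2] as well. *)
Lemma mean2C w w' : bounded_measurable w -> bounded_measurable w' ->
  mean2 w w' = mean2 w' w.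
Proof.
move=> bw bw'; rewrite /mean2 /mean.
transitivity (\int[mu]_x \int[mu]_y (w x * (w' y * K x y))).
  apply: eq_Rintegral => x _; rewrite bm_RintegralZ//.
  exact/bmM/bm_kernel.
rewrite (bm_Fubini mu mu (f := fun z => w z.1 * (w' z.2 * K z.1 z.2))); last first.
  by apply: bmM; [exact: (bm_comp _ bw)|apply: bmM bK; exact: (bm_comp _ bw')].
apply: eq_Rintegral => y _; rewrite -bm_RintegralZ; last exact/bmM/bm_kernel.
by apply: eq_Rintegral => x _; rewrite /= mulrCA Ksym.
Qed.

(* One point is drawn at a time: the expected energy of the points still to be
   drawn, as a function of the point being fixed, is somewhere at most its mean. *)
Lemma exists_upper_sum_le (ws : seq (T -> R)) h :
  (forall w, List.In w ws -> bounded_density w) -> bounded_measurable h ->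
  exists2 xs : seq T, all2 (fun w x => w x != 0) ws xs &
    \sum_(x <- xs) h x + upper_sum K xs
    <= \sum_(w <- ws) mean w h + upper_sum mean2 ws.
Proof.
elim: ws h => [|w ws IH] h dws bh; first by exists [::]; rewrite //= !big_nil.
have dw : bounded_density w by apply: dws; left.
have {}dws v : List.In v ws -> bounded_density v by move=> ?; apply: dws; right.
have [bw _ _] := dw.
pose F x := h x + \sum_(v <- ws) mean v (K x).
have [bF mF] : bounded_measurable (fun x => F x) /\
    mean w F = mean w h + \sum_(v <- ws) mean2 w v.
  have [bS mS] : bounded_measurable (fun x => \sum_(v <- ws) mean v (K x)) /\
    mean w (fun x => \sum_(v <- ws) mean v (K x)) = \sum_(v <- ws) mean2 w v.
    elim: ws dws {IH F} => [|v ws IH] dws.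
      split; first by under eq_fun do rewrite big_nil; exact: bm_cst.
      by under eq_fun do rewrite big_nil; rewrite big_nil mean_cst.
    have [bv _ _] : bounded_density v by apply: dws; left.
    have [|bS mS] := IH; first by move=> u uws; apply: dws; right.
    have bvK := bm_mean_kernel bv.
    under eq_fun do rewrite big_cons; split; first exact: bmD.
    by rewrite big_cons meanD// mS.
  by split; [exact: bmD|rewrite meanD// mS].
have [x wx hx] := exists_le_mean dw bF.
(* Once [x] is fixed, its interaction with the later points is absorbed into the one-point term;
   hence the induction over all [h]. *)
have [|xs wxs hxs] := IH (fun y => h y + K x y) dws.
  exact/bmD/bm_kernel.
exists (x :: xs); first by rewrite /= wx.
rewrite !big_cons/=; move: hx hxs; rewrite mF /F big_split/=.
have -> : \sum_(v <- ws) mean v (fun y => h y + K x y) =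
    \sum_(v <- ws) mean v h + \sum_(v <- ws) mean v (K x).
  elim: ws dws {IH F bF mF wxs} => [|v ws IH] dws; first by rewrite !big_nil addr0.
  have [bv _ _] : bounded_density v by apply: dws; left.
  rewrite !big_cons IH; last by move=> u uws; apply: dws; right.
  rewrite meanD//; last exact: bm_kernel.
  by rewrite addrACA.
lra.
Qed.

(** Points with different indices are independent, so their pairs contribute [mean2]; a diagonal
    pair uses one point twice, and the last sum corrects for this. *)
Lemma exists_double_sum_le (N : nat) (w : 'I_N -> T -> R) :
  (forall i, bounded_density (w i)) ->
  exists2 x : 'I_N -> T, (forall i, w i (x i) != 0) &
    \sum_i \sum_j K (x i) (x j) <=
    \sum_i \sum_j mean2 (w i) (w j) +
    \sum_i (mean (w i) (fun x => K x x) - mean2 (w i) (w i)).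
Proof.
move=> dw; pose ws := [seq w i | i <- enum 'I_N].
(* With weight 1/2 on the diagonal, one-point terms plus upper sum make exactly half of the full
   double sum. *)
have [||xs wxs hxs] := @exists_upper_sum_le ws (fun x => 2^-1 * K x x).
- by move=> v /List.in_map_iff[i [<- _]].
- exact/bmZ/bm_kernel_diag.
have szxs : size xs = N.
  by move: wxs; rewrite all2E => /andP[/eqP <- _]; rewrite size_map size_enum_ord.
pose x (i : 'I_N) := nth point xs i.
have xsE : xs = [seq x i | i <- enum 'I_N].
  apply: (@eq_from_nth _ point); first by rewrite size_map size_enum_ord.
  rewrite szxs => i iN.
  by rewrite (nth_map (Ordinal iN)) ?size_enum_ord// /x nth_enum_ord.
exists x.
  move: wxs; rewrite xsE all2E zip_map all_map => /andP[_ /allP wxs] i.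
  by apply: wxs; rewrite mem_enum.
have sumE (G : 'I_N -> R) : \sum_i G i = \sum_(i <- enum 'I_N) G i.
  by rewrite -big_enum.
have sum2E (G : 'I_N -> 'I_N -> R) : (forall i j, G i j = G j i) ->
    \sum_i \sum_j G i j = \sum_i G i i + 2 * upper_sum G (enum 'I_N).
  move=> Gsym; rewrite !sumE -double_sum_upper//.
  by apply: eq_bigr => i _; rewrite sumE.
have mapE (S : Type) (y : 'I_N -> S) (G : S -> R) :
    \sum_(z <- [seq y i | i <- enum 'I_N]) G z = \sum_i G (y i).
  by rewrite big_map -sumE.
rewrite sum2E; last by move=> i j; rewrite Ksym.
rewrite sum2E; last by move=> i j; apply: mean2C; case: (dw i); case: (dw j).
move: hxs; rewrite xsE /ws (upper_sum_map x) (upper_sum_map w) !mapE => hxs.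
rewrite big_split sumrN/=.
have := hxs; rewrite -mulr_sumr.
under [X in _ <= X + _ -> _]eq_bigr => i _.
  rewrite meanZ; [over|by case: (dw i)|exact: bm_kernel_diag].
rewrite -mulr_sumr; lra.
Qed.

(** Each density has integral 1 and their sum never exceeds [N], so the defect [e] is nonnegative
    with integral 0 and disappears against bounded functions. Averaging over the densities is
    therefore averaging over [mu]. *)
Lemma sum_mean2_partition (N : nat) (w : 'I_N -> T -> R) :
  (forall i, bounded_density (w i)) -> (forall x, \sum_i w i x <= N%:R) ->
  mu setT = 1%E ->
  \sum_i \sum_j mean2 (w i) (w j) = N%:R ^+ 2 * \int[mu]_x \int[mu]_y K x y.
Proof.
move=> dw wN mu1.
have bw i : bounded_measurable (w i) by case: (dw i).
pose e x := N%:R - \sum_i w i x.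
have be : bounded_measurable e by apply: bmB; [exact: bm_cst|exact: bm_sum].
have e0 : \int[mu]_x e x = 0.
  rewrite bm_RintegralB; [|exact: bm_cst|exact: bm_sum].
  rewrite Rintegral_cst//= mu1 mulr1 bm_Rintegral_sum//.
  under eq_bigr => i _ do have [_ _ ->] := dw i.
  by rewrite sumr_const card_ord subrr.
have eh h : bounded_measurable h -> \int[mu]_x (e x * h x) = 0.
  move=> bh; have [_ [C hC]] := bh.
  have beh := bmM be bh.
  apply/eqP; rewrite -normr_le0; apply: le_trans (le_normr_Rintegral _ _) _ => //.
    exact: bm_integrable.
  rewrite -(mulr0 C) -e0 -bm_RintegralZ//; apply: le_bm_Rintegral => [||x].
  - exact: bm_norm.
  - exact: bmZ.
  - have ex0 : 0 <= e x by rewrite subr_ge0.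
    by rewrite normrM (ger0_norm ex0) mulrC ler_wpM2r.
have sumE h : bounded_measurable h -> \sum_i mean (w i) h = N%:R * \int[mu]_x h x.
  move=> bh; rewrite /mean -bm_Rintegral_sum; last by move=> i; exact: bmM.
  rewrite -[LHS]addr0 -[X in _ + X](eh h)// -bm_RintegralD.
  - rewrite -bm_RintegralZ//; apply: eq_Rintegral => x _.
    by rewrite /= -mulr_suml /e mulrBl addrC subrK.
  - by apply: bm_sum => i; exact: bmM.
  - exact: bmM.
have bI : bounded_measurable (fun x => \int[mu]_y K x y).
  exact: (bm_Rintegral1 mu mu bK).
rewrite expr2 -mulrA -sumE// mulr_sumr; apply: eq_bigr => i _.
rewrite -meanZ// /mean2 -mean_sum//; last by move=> j; exact: bm_mean_kernel.
by congr mean; apply/funext => x; rewrite sumE//; exact: bm_kernel.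
Qed.

(** For independent x, y of density [w], the mean of [K x x + K y y - 2 * K x y] is twice the
    left-hand side. *)
Lemma mean_diag_sub_mean2 w b : bounded_density w ->
  (forall x y, w x != 0 -> w y != 0 -> K x x + K y y - 2 * K x y <= b) ->
  mean w (fun x => K x x) - mean2 w w <= b / 2.
Proof.
move=> dw wb; have [bw _ _] := dw; have bd := bm_kernel_diag.
have bmw := bm_mean_kernel bw.
suff : mean w (fun x => mean w (fun y => K x x + K y y - 2 * K x y)) <= b.
  have -> : (fun x => mean w (fun y => K x x + K y y - 2 * K x y)) =
      (fun x => (K x x + mean w (fun y => K y y)) - 2 * mean w (K x)).
    apply/funext => x; have bKx := bm_kernel x.
    rewrite meanB//; [|by apply: bmD => //; exact: bm_cst|exact: bmZ].
    by rewrite meanD//; [rewrite mean_cst// meanZ|exact: bm_cst].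
  rewrite meanB//; [|by apply: bmD => //; exact: bm_cst|exact: bmZ].
  rewrite meanD//; [|exact: bm_cst].
  rewrite mean_cst// meanZ// -/(mean2 w w); lra.
have bD x : bounded_measurable (fun y => K x x + K y y - 2 * K x y).
  by apply: bmB; [apply: bmD => //; exact: bm_cst|exact/bmZ/bm_kernel].
rewrite -(mean_cst b dw); apply: le_mean => //; last 2 first.
- exact: bm_cst.
- move=> x wx; rewrite -[leRHS](mean_cst b dw).
  by apply: le_mean => // [|y wy]; [exact: bm_cst|exact: wb].
- apply: (bm_Rintegral1 mu mu
    (f := fun z => w z.2 * (K z.1 z.1 + K z.2 z.2 - 2 * K z.1 z.2))).
  apply: bmM; first exact: (bm_comp _ bw).
  by apply: bmB; [apply: bmD; exact: (bm_comp _ bd)|exact: bmZ].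
Qed.

End Kernel.
End Sampling.

(** * Measurability of Lipschitz functions *)

Section LipschitzBorel.
Context {R : realType} (M : pmetricType R).

(** Strict sublevel sets of a Lipschitz function are open, and the open lower rays generate the
    Borel sets of the line. *)
Lemma lipschitz_measurable (L : R) (h : M -> R) :
  (forall x y, `|h x - h y| <= L * mdist x y) ->
  measurable_fun setT (h : borel M -> R).
Proof.
move=> hL; apply: (measurability _ (RGenInftyO.measurableE R)).
move=> _ [_ [c ->] <-]; rewrite setTI; apply: sub_sigma_algebra.
rewrite openE => x /=; rewrite in_itv/= => hxc.
(* The sign of [L] is arbitrary; this denominator is positive and dominates [L]. *)
have L1 : 0 < `|L| + 1 by rewrite ltr_wpDl.
apply/nbhs_ballP; exists ((c - h x) / (`|L| + 1)) => /=.
  by rewrite divr_gt0 ?subr_gt0.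
move=> y; rewrite ballEmdist/= ltr_pdivlMr// => xy; rewrite in_itv/=.
have := hL x y; have := ler_norm L; have := mdist_ge0 x y.
have := ler_norm (h y - h x); rewrite distrC; nra.
Qed.

Lemma mdist_lipschitz (x y z : M) : `|mdist x z - mdist y z| <= mdist x y.
Proof.
rewrite ler_norml; have := metric_triangle x y z; have := metric_triangle y x z.
rewrite (metric_sym y x); lra.
Qed.

Hypothesis separableM : separable M.

Lemma dense_sequence :
  exists u : nat -> M, forall (x : M) e, 0 < e -> exists n, mdist x (u n) < e.
Proof.
have [S /countable_injP[f injf] dS] := separableM.
(* [u n] is the point of [S] with code [n], or the default [point] if there is none. *)
pose u n := xget point [set s | S s /\ f s = n].
exists u => x e e0.
have [||s [/interior_subset xs Ss]] := dS (ball x e)°.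
- by exists x; have [] := open_nbhs_ball x (PosNum e0).
- exact: open_interior.
exists (f s); rewrite /u; case: xgetP => [t _ [St ft]|/(_ s)]; last by case.
have -> : t = s by apply: injf; rewrite ?inE.
by move: xs; rewrite ballEmdist.
Qed.

(* A function that is [L]-Lipschitz in its first variable is the infimum of
   [K s y + L * mdist x s] over a countable dense set of [s]. *)
Lemma lipschitz_measurable2 d (T : measurableType d) (L : R) (K : M -> T -> R) :
  (forall x x' y, `|K x y - K x' y| <= L * mdist x x') ->
  (forall x, measurable_fun setT (K x)) ->
  measurable_fun setT (fun z : borel M * T => K z.1 z.2).
Proof.
move=> KL mK; have [u du] := dense_sequence.
apply: (measurability _ (RGenInftyO.measurableE R)).
move=> _ [_ [c ->] <-]; rewrite setTI.
pose F n (z : borel M * T) := K (u n) z.2 + L * mdist (z.1 : M) (u n).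
have mF n : measurable_fun setT (F n).
  apply: measurable_funD; first exact: measurableT_comp (mK (u n)) _.
  apply: measurable_funM; first exact: measurable_cst.
  apply: (measurableT_comp (f := fun x : borel M => mdist (x : M) (u n))) => //.
  apply: (lipschitz_measurable (L := 1)) => x y; rewrite mul1r.
  exact: mdist_lipschitz.
rewrite [X in measurable X](_ : _ = \bigcup_n (F n @^-1` `]-oo, c[%classic)).
  by apply: bigcupT_measurable => n; rewrite -[X in measurable X]setTI; exact: mF.
apply/seteqP; split => -[x y]/=; rewrite in_itv/=.
  (* [F n] exceeds [K x y] by at most [2 * L * mdist x (u n)]: one share from the Lipschitz bound,
     one from the added term. *)
  have L1 : 0 < 2 * `|L| + 1 by rewrite ltr_wpDl// mulr_ge0.
  move=> Kc; have [|n xn] := du x ((c - K x y) / (2 * `|L| + 1)).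
    by rewrite divr_gt0 ?subr_gt0.
  exists n => //=; rewrite in_itv/= /F/=.
  move: xn; rewrite ltr_pdivlMr// => xn.
  have := KL (u n) x y; rewrite metric_sym.
  have := ler_norm L; have := mdist_ge0 x (u n).
  have := ler_norm (K (u n) y - K x y); nra.
move=> [n _] /=; rewrite in_itv/= /F/=.
have := KL x (u n) y; have := ler_norm (K x y - K (u n) y); lra.
Qed.

End LipschitzBorel.

(** * Sampling one point from each block of the partition *)

Section Partition.
Context {R : realType} (M : pmetricType R).
Hypothesis compactM : compact [set: M].
Hypothesis separableM : separable M.

(** The distance to the base point is continuous, hence bounded by compactness; the triangle
    inequality doubles the bound. *)
Lemma mdist_bounded : exists C, forall x y : M, mdist x y <= C.
Proof.
pose h (x : M) : R := mdist x point.
have ch : {within [set: M], continuous h}.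
  apply: continuous_subspaceT => x; apply/cvgrPdist_lt => e e0.
  apply/nbhs_ballP; exists e => //= y; rewrite ballEmdist/=.
  exact/le_lt_trans/mdist_lipschitz.
have /compact_bounded[C [_ hC]] := continuous_compact ch compactM.
exists ((`|C| + 1) * 2) => x y.
have hle z : h z <= `|C| + 1.
  apply: le_trans (ler_norm _) _; apply: (hC (`|C| + 1)); last by exists z.
  by rewrite ltr_pwDr// ler_norm.
have := metric_triangle x point y; rewrite (metric_sym point y).
by have := hle x; have := hle y; rewrite /h; lra.
Qed.

(** Symmetry carries the Lipschitz bound to the second variable. For boundedness, the arguments are
    moved to the base point one at a time. *)
Lemma lipschitz_kernel_bm (L : R) (K : M -> M -> R) :
  (forall x x' y, `|K x y - K x' y| <= L * mdist x x') ->
  (forall x y, K x y = K y x) ->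
  bounded_measurable (fun z : borel M * borel M => K z.1 z.2).
Proof.
move=> KL Ksym; split.
  apply: (lipschitz_measurable2 separableM (T := borel M) KL) => x.
  by apply: (lipschitz_measurable (L := L)) => y z; rewrite !(Ksym x); exact: KL.
have [C hC] := mdist_bounded.
exists (`|K point point| + 2 * (`|L| * C)) => -[x y] /=.
have Kp u v w : `|K u w - K v w| <= `|L| * C.
  apply: le_trans (KL _ _ _) _; apply: (@le_trans _ _ (`|L| * mdist u v)).
    by rewrite ler_wpM2r ?mdist_ge0 ?ler_norm.
  by rewrite ler_wpM2l.
have -> : K x y = K point point + (K x y - K point y) + (K y point - K point point).
  rewrite (Ksym y); ring.
rewrite (le_trans (ler_normD _ _))// (le_trans (lerD (ler_normD _ _) (Kp _ _ _)))//.
have := Kp x point y; lra.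
Qed.

Variables (mu : probability (borel M) R) (N : nat) (V : 'I_N -> set (borel M)).
Hypothesis partV : equal_measure_partition mu V.

(** Without blocks, the complement of their union would be the whole space, of measure 1 instead of
    0. *)
Lemma partition_gt0 : (0 < N)%N.
Proof.
case: N V partV => // V0 [_ + _ _]; rewrite (_ : \bigcup_i V0 i = set0).
  by rewrite setC0 probability_setT => -[] /eqP; rewrite oner_eq0.
by rewrite -subset0 => x [[]].
Qed.

Lemma diam_ge0 (A : set M) x : A x -> (0 <= diam A)%E.
Proof.
move=> Ax; apply: ereal_sup_ubound.
by exists x => //; exists x; rewrite ?mdistxx.
Qed.

(** The point of [A] excludes the empty set, whose supremum is -oo. *)
Lemma diam_fin_num (A : set M) x : A x -> diam A \is a fin_num.
Proof.
move=> Ax; rewrite ge0_fin_numE ?(diam_ge0 Ax)//.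
have [C hC] := mdist_bounded; apply: le_lt_trans (ltry C).
by apply: ge_ereal_sup => _ [u _ [v _ <-]]; rewrite lee_fin.
Qed.

Lemma mdist_le_diam (A : set M) x y : A x -> A y -> mdist x y <= fine (diam A).
Proof.
move=> Ax Ay; rewrite -lee_fin fineK ?(diam_fin_num Ax)//.
by apply: ereal_sup_ubound; exists x => //; exists y.
Qed.

(* The blocks of the partition only overlap in null sets; removing the overlaps
   makes points drawn from different blocks distinct. *)
Definition block_core i : set (borel M) := V i `\` \big[setU/set0]_(j | j != i) V j.

Lemma measurable_core i : measurable (block_core i).
Proof.
have [mV _ _ _] := partV.
by apply: measurableD => //; exact: bigsetU_measurable.
Qed.

Lemma core_disjoint i j x : block_core i x -> block_core j x -> i = j.
Proof.
move=> [Vi _] [_ nVj]; apply: contrapT => /eqP ij; apply: nVj.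
by rewrite (bigD1 i)//=; left.
Qed.

Lemma mu_core i : mu (block_core i) = (N%:R^-1)%:E.
Proof.
have [mV _ V0 VN] := partV.
set B := \big[setU/set0]_(j | j != i) V j.
have [mB B0] : measurable B /\ mu (V i `&` B) = 0%E.
  rewrite /B; elim/big_ind : _ => [|A A' [mA A0] [mA' A'0]|j ji].
  - by rewrite setI0 measure0.
  - split; first exact: measurableU.
    by rewrite setIUr null_set_setU//; exact: measurableI.
  - by split=> //; apply: V0; rewrite eq_sym.
by rewrite -(VN i) (measureDI mu (mV i) mB) [X in (_ + X)%E]B0 adde0.
Qed.

Definition block_density i (x : borel M) : R := N%:R * \1_(block_core i) x.

Lemma block_density_neq0 i x : block_density i x != 0 -> block_core i x.
Proof.
rewrite /block_density indicE; have [/set_mem//|_] := boolP (x \in block_core i).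
by rewrite mulr0 eqxx.
Qed.

Lemma bounded_block_density i : bounded_density mu (block_density i).
Proof.
have N0 : N%:R != 0 :> R by rewrite pnatr_eq0 -lt0n partition_gt0.
have b1 : bounded_measurable (\1_(block_core i) : borel M -> R).
  split; first by apply: measurable_indic; exact: measurable_core.
  by exists 1 => x; rewrite indicE; case: (_ \in _); rewrite ?normr1 ?normr0.
split; first exact: bmZ.
  by move=> x; rewrite mulr_ge0// indicE.
rewrite bm_RintegralZ// /Rintegral integral_indic//; last exact: measurable_core.
by rewrite setIT [X in fine X]mu_core/= divff.
Qed.

Lemma sum_block_density x : \sum_i block_density i x <= N%:R.
Proof.
rewrite /block_density -mulr_sumr ler_piMr//.
have [[i xi]|nx] := pselect (exists i, block_core i x).
  rewrite (bigD1 i)//= big1 ?addr0 ?indicE ?(mem_set xi)// => j ji.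
  by rewrite indicE memNset// => /(core_disjoint xi) ij; rewrite ij eqxx in ji.
by rewrite big1 => // i _; rewrite indicE memNset// => xi; apply: nx; exists i.
Qed.

(** The common source of both inequalities. Inside a block, [c * mdist x y] is at most [c] times the
    diameter, and half of it bounds the diagonal defect. Since the cores are disjoint, the chosen
    points are distinct and form a set of exactly [N] elements. *)
Lemma exists_fset_kernel_le (L c : R) (K : M -> M -> R) :
  (forall x x' y, `|K x y - K x' y| <= L * mdist x x') ->
  (forall x y, K x y = K y x) ->
  0 <= c -> (forall x y, K x x + K y y - 2 * K x y <= c * mdist x y) ->
  exists2 D : {fset M}, #|` D| = N &
    \sum_(x <- D) \sum_(y <- D) K x y <=
    N%:R ^+ 2 * \int[mu]_x \int[mu]_y K x y
    + c / 2 * \sum_i fine (diam (V i)).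
Proof.
move=> KL Ksym c0 Kc; have bK := lipschitz_kernel_bm KL Ksym.
have dw := bounded_block_density.
have [x wx sumK] := exists_double_sum_le bK Ksym dw.
have xinj : injective x.
  move=> i j ij; apply: (core_disjoint (block_density_neq0 (wx i))).
  by rewrite ij; exact/block_density_neq0.
exists [fset (x i : M) | i in 'I_N]%fset.
  by rewrite card_imfset//= size_enum_ord.
rewrite big_imfset/=; last by move=> i j _ _; exact: xinj.
under eq_bigr do (rewrite big_imfset/=; last by move=> i' j _ _; exact: xinj).
rewrite big_enum/=; under eq_bigr do rewrite big_enum/=.
apply: le_trans sumK _.
rewrite sum_mean2_partition//; [|exact: sum_block_density|exact: probability_setT].
rewrite lerD2l mulr_sumr; apply: ler_sum => i _.
rewrite mulrAC; apply: mean_diag_sub_mean2 => // u v.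
move=> /block_density_neq0[uV _] /block_density_neq0[vV _].
apply: le_trans (Kc u v) _; rewrite ler_wpM2l//.
exact: mdist_le_diam.
Qed.

End Partition.

(* Unlike [ge0_subset_integral], this needs no measurability, neither of the
   domains nor of the integrand. *)
Lemma le_ge0_integral_subset d (T : measurableType d) (R : realType)
    (mu : {measure set T -> \bar R}) (A B : set T) (f : T -> \bar R) :
  (forall x, 0 <= f x)%E -> A `<=` B ->
  (\int[mu]_(x in A) f x <= \int[mu]_(x in B) f x)%E.
Proof.
move=> f0 AB; rewrite !ge0_integralE//; apply: ereal_sup_le => _ [h hA <-].
exists h => // x; apply: le_trans (hA x) _; rewrite !patchE.
case: ifPn => [/set_mem/AB/mem_set -> //|_].
by case: ifPn.
Qed.

Lemma bm_Rintegral_prod d d' (T : measurableType d) (T' : measurableType d')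
    (R : realType) (mu : {finite_measure set T -> \bar R})
    (nu : {finite_measure set T' -> \bar R}) (f : T * T' -> R) :
  bounded_measurable f ->
  \int[prod_measure mu nu]_z f z = \int[mu]_x \int[nu]_y f (x, y).
Proof.
move=> bf; rewrite /Rintegral; congr fine.
rewrite -(integral12_prod_meas1 (m1 := mu) (m2 := nu) (bm_integrable_prod mu nu bf)).
by apply: eq_integral => x _; rewrite -bm_RintegralE//; exact: bm_pair2.
Qed.

(** * The kernel of the ball discrepancy *)

Section BallKernel.
Context {R : realType} (M : pmetricType R).
Hypothesis separableM : separable M.
Variable mu : probability (borel M) R.
Variable xi : {finite_measure set (measurableTypeR R) -> \bar R}.

Local Notation Omega := (measurableTypeR R * borel M)%type.

(** A pair [z = (r, y)] stands for the closed ball of radius [r] centred at [y]. *)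
Definition ball_indic (x : M) (z : Omega) : R := (mdist x (z.2 : M) <= z.1)%R%:R.

(** Membership in the ball is the condition [g <= 0], and separability makes the metric, hence [g],
    jointly measurable. *)
Lemma bm_ball_indic2 :
  bounded_measurable (fun u : borel M * Omega => ball_indic u.1 u.2).
Proof.
split; last first.
  exists 1 => u; rewrite /ball_indic.
  by case: (mdist _ _ <= _); rewrite ?normr1 ?normr0.
pose g (u : borel M * Omega) : R := mdist (u.1 : M) (u.2.2 : M) - u.2.1.
have md : measurable_fun setT (fun u : borel M * borel M => mdist (u.1 : M) (u.2 : M)).
  apply: (lipschitz_measurable2 separableM (T := borel M) (L := 1)
    (K := fun x y => mdist x (y : M))).
    by move=> x x' y; rewrite mul1r; exact: mdist_lipschitz.
  move=> x; apply: (lipschitz_measurable (L := 1) (h := fun y : M => mdist x y)).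
  by move=> y z; rewrite mul1r !(metric_sym x); exact: mdist_lipschitz.
have mg : measurable_fun setT g.
  apply: measurable_funB.
    apply: (measurableT_comp md (g := fun u : borel M * Omega => (u.1, u.2.2))).
    apply: measurable_fun_pair => //.
    exact: (measurableT_comp measurable_snd measurable_snd).
  exact: (measurableT_comp measurable_fst measurable_snd).
rewrite (_ : (fun u => _) = \1_(g @^-1` `]-oo, 0%R]%classic)).
  apply: measurable_indic; rewrite -[X in measurable X]setTI.
  exact: mg.
apply/funext => u; rewrite indicE /ball_indic; congr (nat_of_bool _)%:R.
by apply/idP/idP => [h|/set_mem]; [apply/mem_set|]; rewrite /= in_itv/= /g subr_le0.
Qed.

(** The form as an integral of indicators gives measurability in radius and centre through
    [bm_Rintegral1]. *)
Definition ball_measure (z : Omega) : R := \int[mu]_x ball_indic x z.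

Lemma bm_ball_indic x : bounded_measurable (ball_indic x).
Proof. exact: (bm_pair2 bm_ball_indic2 x). Qed.

Lemma bm_ball_indic_center z : bounded_measurable (fun x : borel M => ball_indic x z).
Proof. exact: (bm_pair1 bm_ball_indic2 z). Qed.

Lemma bm_ball_measure : bounded_measurable ball_measure.
Proof.
apply: (bm_Rintegral1 (prod_measure xi mu) mu
  (f := fun u : Omega * borel M => ball_indic u.2 u.1)).
exact: (bm_comp (h := unstable.swap) (@measurable_swap _ _ _ _) bm_ball_indic2).
Qed.

Lemma ball_measureE r y : ball_measure (r, y) = fine (mu (cball r (y : M))).
Proof.
rewrite -[X in fine (mu X)]setIT -integral_indic//; last first.
  have [mb _] := bm_ball_indic_center (r, y).
  rewrite (_ : cball _ _ = (fun x : borel M => ball_indic x (r, y)) @^-1` [set 1]).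
    by rewrite -[X in measurable X]setTI; exact: mb.
  apply/seteqP; split => x; rewrite /cball /ball_indic/=; first by move=> ->.
  by case: (mdist _ _ <= _) => // /eqP; rewrite eq_sym oner_eq0.
congr fine; apply: eq_integral => x _; congr EFin; rewrite indicE /ball_indic.
congr (nat_of_bool _)%:R.
by apply/idP/idP => [h|/set_mem//]; apply/mem_set.
Qed.

Definition ball_deviation (x : M) (z : Omega) : R := ball_indic x z - ball_measure z.

Lemma bm_ball_deviation x : bounded_measurable (ball_deviation x).
Proof. by apply: bmB; [exact: bm_ball_indic|exact: bm_ball_measure]. Qed.

Lemma ball_deviation_le1 x z : `|ball_deviation x z| <= 1.
Proof.
have [p0 p1] : 0 <= ball_measure z /\ ball_measure z <= 1.
  split; first by apply: Rintegral_ge0 => y _; rewrite /ball_indic.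
  have -> : 1 = \int[mu]_(x in [set: borel M]) 1 :> R.
    by rewrite Rintegral_cst//= mul1r [X in fine X]probability_setT.
  apply: le_bm_Rintegral; [exact: bm_ball_indic_center|exact: bm_cst|].
  by move=> y; rewrite /ball_indic; case: (mdist _ _ <= _).
rewrite /ball_deviation /ball_indic ler_norml.
by case: (mdist _ _ <= _) => /=; lra.
Qed.

Definition ball_kernel (x y : M) : R :=
  \int[prod_measure xi mu]_z (ball_deviation x z * ball_deviation y z).

Lemma ball_kernelC x y : ball_kernel x y = ball_kernel y x.
Proof. by apply: eq_Rintegral => z _; rewrite mulrC. Qed.

Variable c0 : R.
Hypothesis c0_gt0 : 0 < c0.
Hypothesis xi_le : forall a b : R, distances M a -> distances M b -> a <= b ->
  (xi `[a, b[%classic <= (c0 * `|a - b|)%:E)%E.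

(** With x the nearer point to y, the indicators differ exactly for r from [mdist x y] included to
    [mdist x' y] excluded, the balls being closed. Both endpoints are distances, so [xi_le]
    applies. *)
Lemma Rintegral_ball_indic_sub (x x' y : M) :
  \int[xi]_r `|ball_indic x (r, y) - ball_indic x' (r, y)| <= c0 * mdist x x'.
Proof.
wlog xx' : x x' / mdist x y <= mdist x' y => [hw|].
  have [|/ltW] := leP (mdist x y) (mdist x' y); first exact: hw.
  by move=> /hw; rewrite metric_sym; under eq_Rintegral do rewrite distrC.
have -> : \int[xi]_r `|ball_indic x (r, y) - ball_indic x' (r, y)| =
    fine (xi `[mdist x y, mdist x' y[%classic).
  rewrite -[X in fine (xi X)]setIT -integral_indic//.
  congr fine; apply: eq_integral => r _; congr EFin.
  rewrite /ball_indic indicE mem_setE in_itv/=.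
  have [xr|xr] := leP (mdist x y) r; have [x'r|x'r] := leP (mdist x' y) r => /=.
  - by rewrite subrr normr0.
  - by rewrite subr0 normr1.
  - by have := le_lt_trans (le_trans xx' x'r) xr; rewrite ltxx.
  - by rewrite subrr normr0.
rewrite -lee_fin fineK ?fin_num_measure//.
apply: le_trans (xi_le _ _ xx') _.
- by exists x => //; exists y.
- by exists x' => //; exists y.
by rewrite lee_fin ler_wpM2l ?(ltW c0_gt0)// mdist_lipschitz.
Qed.

Lemma Rintegral_prod_ball_indic_sub x x' :
  \int[prod_measure xi mu]_z `|ball_indic x z - ball_indic x' z|
  <= c0 * mdist x x'.
Proof.
have bd : bounded_measurable (fun z => `|ball_indic x z - ball_indic x' z|).
  by apply: bm_norm; apply: bmB; exact: bm_ball_indic.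
rewrite bm_Rintegral_prod// (bm_Fubini xi mu bd).
have -> : c0 * mdist x x' = \int[mu]_(y in [set: borel M]) (c0 * mdist x x').
  by rewrite Rintegral_cst//= [X in fine X]probability_setT mulr1.
apply: le_bm_Rintegral; [|exact: bm_cst|by move=> y; exact: Rintegral_ball_indic_sub].
apply: (bm_Rintegral1 mu xi
  (f := fun u => `|ball_indic x (u.2, u.1) - ball_indic x' (u.2, u.1)|)).
exact: (bm_comp (h := unstable.swap) (@measurable_swap _ _ _ _) bd).
Qed.

(** The ball measures cancel in the difference of two deviations, and the remaining factor is at
    most 1 in absolute value. *)
Lemma ball_kernel_lipschitz x x' y :
  `|ball_kernel x y - ball_kernel x' y| <= c0 * mdist x x'.
Proof.
have bP u v := bmM (bm_ball_deviation u) (bm_ball_deviation v).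
rewrite /ball_kernel -bm_RintegralB//.
apply: le_trans (le_normr_Rintegral _ _) _ => //.
  by apply: bm_integrable; exact: bmB.
apply: le_trans (Rintegral_prod_ball_indic_sub x x').
have bd : bounded_measurable (fun z => `|ball_indic x z - ball_indic x' z|).
  by apply: bm_norm; apply: bmB; exact: bm_ball_indic.
apply: le_bm_Rintegral => //; first by apply: bm_norm; exact: bmB.
move=> z; rewrite -mulrBl normrM.
have -> : ball_deviation x z - ball_deviation x' z = ball_indic x z - ball_indic x' z.
  by rewrite /ball_deviation; ring.
by rewrite ler_piMr// ball_deviation_le1.
Qed.

(** The integrand is the square of a difference of two indicators, which equals its absolute
    value. *)
Lemma ball_kernel_sqr_le x y :
  ball_kernel x x + ball_kernel y y - 2 * ball_kernel x y <= c0 * mdist x y.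
Proof.
have bP u v := bmM (bm_ball_deviation u) (bm_ball_deviation v).
rewrite /ball_kernel -bm_RintegralD// -bm_RintegralZ// -bm_RintegralB//; last 2 first.
- exact: bmD.
- exact: bmZ.
apply: le_trans (Rintegral_prod_ball_indic_sub x y).
apply: le_bm_Rintegral.
- by apply: bmB; [exact: bmD|exact: bmZ].
- by apply: bm_norm; apply: bmB; exact: bm_ball_indic.
- move=> z; rewrite /ball_deviation /ball_indic; set p := ball_measure z.
  case: (mdist x _ <= _); case: (mdist y _ <= _) => /=.
  + by rewrite subrr normr0; nra.
  + by rewrite subr0 normr1; nra.
  + by rewrite distrC subr0 normr1; nra.
  + by rewrite subrr normr0; nra.
Qed.

(** For each fixed ball the deviation has [mu]-mean 0; Fubini allows integrating over the point
    first. *)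
Lemma Rintegral_ball_kernel : \int[mu]_x \int[mu]_y ball_kernel x y = 0.
Proof.
have K0 x : \int[mu]_y ball_kernel x y = 0.
  have bdev2 : bounded_measurable (fun u : borel M * Omega => ball_deviation u.1 u.2).
    apply: bmB; first exact: bm_ball_indic2.
    exact: (bm_comp (h := snd) _ bm_ball_measure).
  rewrite /ball_kernel (bm_Fubini mu (prod_measure xi mu)
    (f := fun u => ball_deviation x u.2 * ball_deviation u.1 u.2)); last first.
    by apply: bmM => //; exact: (bm_comp (h := snd) _ (bm_ball_deviation x)).
  rewrite -[RHS](mul0r (fine (prod_measure xi mu setT))) -Rintegral_cst//.
  apply: eq_Rintegral => z _ /=.
  rewrite bm_RintegralZ; last exact: (bm_pair1 bdev2 z).
  rewrite bm_RintegralB; [|exact: bm_ball_indic_center|exact: bm_cst].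
  by rewrite Rintegral_cst//= [X in _ * fine X]probability_setT mulr1 subrr mulr0.
under eq_Rintegral do rewrite K0.
by rewrite Rintegral_cst//= mul0r.
Qed.

(** The counting error of a ball is the sum [g] of the deviations over [D], and expanding its square
    gives the kernel. The kernel integrates over all real radii, which can only increase the
    integral of a square. *)
Lemma discrepancy_le (D : {fset M}) :
  (discrepancy mu xi D <= (\sum_(x <- D) \sum_(y <- D) ball_kernel x y)%:E)%E.
Proof.
pose g z := \sum_(x <- D) ball_deviation x z.
have bg : bounded_measurable g by apply: bm_sum => x; exact: bm_ball_deviation.
have bgg := bmM bg bg.
have -> : \sum_(x <- D) \sum_(y <- D) ball_kernel x y =
    \int[prod_measure xi mu]_z (g z * g z).
  have bP u v := bmM (bm_ball_deviation u) (bm_ball_deviation v).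
  under eq_bigr => x _ do rewrite -bm_Rintegral_sum//.
  rewrite -bm_Rintegral_sum; last by move=> x; exact: bm_sum.
  apply: eq_Rintegral => z _; rewrite [in RHS]/g mulr_suml.
  by apply: eq_bigr => x _; rewrite mulr_sumr.
have gE r y : #|` [fset x in D | x \in cball r (y : M)]%fset|%:R
    - #|` D|%:R * fine (mu (cball r (y : M))) = g (r, y).
  rewrite -ball_measureE /g /ball_deviation big_split/= sumrN.
  rewrite [X in _ = _ - X]big_const_seq count_predT iter_addr_0 mulr_natl.
  congr (_ - _); rewrite card_fset_sum1 -big_fset_condE natr_sum big_mkcond/=.
  apply: eq_bigr => x _; rewrite /ball_indic/=.
  have -> : (x \in cball r (y : M)) = (mdist x y <= r).
    by apply/idP/idP => [/set_mem//|h]; apply/mem_set.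
  by case: (mdist _ _ <= _).
have -> : discrepancy mu xi D =
    (\int[xi]_(r in distances M) (\int[mu]_y (g (r, y) * g (r, y)))%:E)%E.
  apply: eq_integral => r _; rewrite /ball_discrepancy -bm_RintegralE; last first.
    exact: (bm_pair2 bgg r).
  by apply: eq_integral => y _; rewrite gE expr2.
apply: le_trans (le_ge0_integral_subset _ _ (subsetT _)) _ => [r|].
  by rewrite lee_fin Rintegral_ge0// => y _; rewrite -expr2 sqr_ge0.
rewrite bm_RintegralE; last exact: (bm_Rintegral1 xi mu bgg).
by rewrite bm_Rintegral_prod.
Qed.

End BallKernel.

(** * Finiteness of the mean distance and average diameter, and the two inequalities *)

Lemma bm_mdist (R : realType) (M : pmetricType R) :
  compact [set: M] -> separable M ->
  bounded_measurable (fun z : borel M * borel M => mdist (z.1 : M) (z.2 : M)).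
Proof.
move=> cM sM; apply: (lipschitz_kernel_bm cM sM (L := 1)); last exact: metric_sym.
by move=> x y z; rewrite mul1r; exact: mdist_lipschitz.
Qed.

Lemma mean_distE (R : realType) (M : pmetricType R) (mu : probability (borel M) R) :
  compact [set: M] -> separable M ->
  mean_dist mu = (\int[mu]_x \int[mu]_y mdist (x : M) (y : M))%:E.
Proof.
move=> cM sM; have bd := bm_mdist cM sM.
rewrite -bm_RintegralE; last exact: (bm_Rintegral1 mu mu bd).
by apply: eq_integral => x _; rewrite -bm_RintegralE//; exact: (bm_pair2 bd x).
Qed.

(** Blocks have positive measure, so they are nonempty and their diameters are finite. *)
Lemma avg_diamE (R : realType) (M : pmetricType R) (mu : probability (borel M) R)
    (N : nat) (V : 'I_N -> set (borel M)) :
  compact [set: M] -> equal_measure_partition mu V ->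
  avg_diam V = (N%:R^-1 * \sum_i fine (diam (V i)))%:E.
Proof.
move=> cM partV; rewrite /avg_diam EFinM -sumEFin; congr (_ * _)%E.
apply: eq_bigr => i _; rewrite fineK//.
have N0 : N%:R != 0 :> R by rewrite pnatr_eq0 -lt0n (partition_gt0 partV).
have [_ _ _ VN] := partV.
have [x Vx] : V i !=set0.
  apply/set0P/eqP => V0; have := VN i; rewrite V0 measure0 => -[] /esym/eqP.
  by rewrite invr_eq0 (negbTE N0).
exact: diam_fin_num Vx.
Qed.

Local Open Scope ereal_scope.

Theorem theorem3p2 (R : realType) (M : pmetricType R)
    (compactM : compact [set: M]) (separableM : separable M)
    (mu : probability (borel M) R)
    (N : nat) (V : 'I_N -> set (borel M))
    (partV : equal_measure_partition mu V) :
  max_sum_dist M N >= (N%:R ^+ 2)%:E * mean_dist mu - N%:R%:E * avg_diam V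
  /\
  forall (xi : {finite_measure set (measurableTypeR R) -> \bar R}) (c0 : R),
    xi (~` distances M) = 0 ->
    (0 < c0)%R ->
    (forall a b : R, distances M a -> distances M b -> (a <= b)%R ->
       xi `[a, b[%classic <= (c0 * `|a - b|)%:E) ->
    min_discrepancy mu xi N <= (2^-1 * c0 * N%:R)%:E * avg_diam V.
Proof.
have N0 : (N%:R != 0 :> R)%R by rewrite pnatr_eq0 -lt0n (partition_gt0 partV).
rewrite (avg_diamE compactM partV); split.
  (* The diagonal of this kernel vanishes, so its defect expression is twice the distance: hence
     [c := 2]. *)
  have [||||D DN] := exists_fset_kernel_le compactM separableM partV
    (L := 1) (c := 2) (K := fun x y => - mdist x y)%R.
  - by move=> x y z; rewrite mul1r opprK addrC distrC mdist_lipschitz.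
  - by move=> x y; rewrite metric_sym.
  - by [].
  - by move=> x y; rewrite !mdistxx; lra.
  have -> : (\int[mu]_x \int[mu]_y - mdist (x : M) (y : M) =
      - \int[mu]_x \int[mu]_y mdist (x : M) (y : M))%R.
    have bd := bm_mdist compactM separableM.
    rewrite -bm_RintegralN; last exact: (bm_Rintegral1 mu mu bd).
    apply: eq_Rintegral => x _.
    by rewrite -bm_RintegralN//; exact: (bm_pair2 bd x).
  have -> : (\sum_(x <- D) \sum_(y <- D) - mdist x y = - sum_dist D)%R.
    by rewrite /sum_dist -sumrN; apply: eq_bigr => x _; rewrite sumrN.
  rewrite divff// mul1r => hD.
  apply: (@le_trans _ _ (sum_dist D)%:E); last first.
    by apply: ereal_sup_ubound; exists D.
  rewrite mean_distE// -!EFinM -EFinB lee_fin mulrA divff// mul1r.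
  by move: hD; rewrite mulrN; lra.
move=> xi c0 _ c0_gt0 xi_le.
have [||||D DN] := exists_fset_kernel_le compactM separableM partV
    (L := c0) (c := c0) (K := ball_kernel mu xi).
- exact: ball_kernel_lipschitz.
- exact: ball_kernelC.
- exact: ltW.
- exact: ball_kernel_sqr_le.
(* The kernel has mean zero, so only [c0 / 2] times the sum of the diameters remains. *)
rewrite Rintegral_ball_kernel// mulr0 add0r => hD.
apply: (@le_trans _ _ (discrepancy mu xi D)).
  by apply: ereal_inf_lbound; exists D.
apply: le_trans (discrepancy_le separableM mu xi D) _.
rewrite -EFinM lee_fin mulrA -(mulrA (2^-1 * c0)%R) divff// mulr1.
by rewrite (mulrC 2^-1%R).
Qed.
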